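(* Let $\alpha\in[0,1]$, let $G$ be a simple undirected graph on $n$ vertices, and let $\lambda\in\mathbb{R}$. Let $x\in\mathbb{R}^n$ be such that $\sum_{i}x_i=0$ and $x_v=0$ for some $v\in V(G)$, and let $N_v$ be the set of edges of $G$ that contain the vertex $v$. If $v$ is adjacent to every vertex $u\in V(G)$ such that $x_u\neq 0$, then $B(G)x=\lambda x$ if and only if $B(G-N_v)x=(\lambda-1+\alpha)x$.
   Context: For a graph $G$ on $n$ vertices, $A(G)$ is the adjacency matrix, $D(G)$ the diagonal degree matrix, $L(G)=D(G)-A(G)$ the Laplacian, and $B(G)=B_\alpha(G)=\alpha A(G)+(1-\alpha)L(G)$. $G-N_v$ denotes the graph on the same vertex set $V(G)$ obtained by deleting the edges in $N_v$ (the vertex $v$ is kept). *)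

(* Defs.v *)
From HB Require Import structures.
From mathcomp Require Import all_boot all_order all_algebra.
From mathcomp Require Import reals.

Set Implicit Arguments.
Unset Strict Implicit.
Unset Printing Implicit Defensive.

Import Order.TTheory GRing.Theory Num.Theory.
Local Open Scope ring_scope.

Record sgraph (n : nat) := SGraph {
  adj : rel 'I_n;
  adj_sym : symmetric adj;
  adj_irrefl : irreflexive adj
}.

Section Graph.
Variable n : nat.
Implicit Types (G : sgraph n) (F : {set {set 'I_n}}) (u v : 'I_n).

Definition edges G : {set {set 'I_n}} :=
  [set [set p.1; p.2] | p in [pred p : 'I_n * 'I_n | adj G p.1 p.2]].

Definition edges_at G v : {set {set 'I_n}} := [set e in edges G | v \in e].

Definition deg G v : nat := #|[set u | adj G v u]|.

Definition del_adj G F : rel 'I_n :=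
  fun u v => adj G u v && ([set u; v] \notin F).

Lemma del_adj_sym G F : symmetric (del_adj G F).
Proof. by move=> u v; rewrite /del_adj adj_sym setUC. Qed.

Lemma del_adj_irrefl G F : irreflexive (del_adj G F).
Proof. by move=> u; rewrite /del_adj adj_irrefl. Qed.

Definition del_edges G F : sgraph n :=
  SGraph (del_adj_sym G F) (del_adj_irrefl G F).

Variable R : realType.

Definition adjacency_mx G : 'M[R]_n := \matrix_(i, j) (adj G i j)%:R.

Definition degree_mx G : 'M[R]_n := diag_mx (\row_i (deg G i)%:R).

Definition laplacian_mx G : 'M[R]_n := degree_mx G - adjacency_mx G.

Definition B_mx (alpha : R) G : 'M[R]_n :=
  alpha *: adjacency_mx G + (1 - alpha) *: laplacian_mx G.

End Graph.

(* Main.v *)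
(* The vector [x] is supported on the neighbours of [v], so row [v] of [B x] is
   a multiple of the sum of [x], which is zero.  In any other row, deleting the
   edges at [v] leaves the sum of [x] over the neighbours unchanged because
   [x v = 0], and lowers by one the degree of every vertex in the support of
   [x].  Hence [B (G - N_v) x = B G x - (1 - alpha) x]. *)
Require Import Defs.
From HB Require Import structures.
From mathcomp Require Import all_boot all_order all_algebra.
From mathcomp Require Import reals.
From mathcomp Require Import ring.

Set Implicit Arguments.
Unset Strict Implicit.
Unset Printing Implicit Defensive.

Import Order.TTheory GRing.Theory Num.Theory.
Local Open Scope ring_scope.

Lemma adj_del_edges_at n (G : sgraph n) (v i j : 'I_n) :
  adj (del_edges G (edges_at G v)) i j = [&& adj G i j, i != v & j != v].
Proof.
rewrite /= /del_adj; case Gij: (adj G i j) => //=.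
have -> : ([set i; j] \in edges_at G v) = (v \in [set i; j]).
  by rewrite inE andb_idl // => _; apply/imsetP; exists (i, j).
by rewrite !inE negb_or eq_sym (eq_sym v).
Qed.

(** Since [B = (2 * alpha - 1) A + (1 - alpha) D] and a degree is itself a sum of adjacencies, both
    parts merge into one sum over neighbours, so deleting an edge just drops a summand. *)
Lemma B_mxE (R : realType) (alpha : R) n (G : sgraph n) (x : 'cV[R]_n) i :
  (B_mx alpha G *m x) i 0 =
  \sum_j (adj G i j)%:R * ((2 * alpha - 1) * x j 0 + (1 - alpha) * x i 0).
Proof.
have degE : (deg G i)%:R = \sum_j (adj G i j)%:R :> R.
  rewrite /deg -sum1_card natr_sum big_mkcond; apply: eq_bigr => j _.
  by rewrite inE; case: (adj G i j).
have adjE : (adjacency_mx R G *m x) i 0 = \sum_j (adj G i j)%:R * x j 0.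
  by rewrite mxE; apply: eq_bigr => j _; rewrite mxE.
have degmE : (degree_mx R G *m x) i 0 = (deg G i)%:R * x i 0.
  by rewrite mul_diag_mx !mxE.
rewrite /B_mx /laplacian_mx mulmxDl -!scalemxAl mulmxBl.
transitivity (alpha * (adjacency_mx R G *m x) i 0 + (1 - alpha) *
  ((degree_mx R G *m x) i 0 - (adjacency_mx R G *m x) i 0)).
  by rewrite !mxE.
rewrite adjE degmE degE.
under [RHS]eq_bigr do rewrite mulrDr mulrCA.
rewrite big_split /= -mulr_sumr -mulr_suml.
ring.
Qed.

Lemma B_mx_del_edges_at (R : realType) (alpha : R) n (G : sgraph n)
    (x : 'cV[R]_n) (v : 'I_n) :
  \sum_i x i 0 = 0 -> x v 0 = 0 -> (forall u, x u 0 != 0 -> adj G v u) ->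
  B_mx alpha (del_edges G (edges_at G v)) *m x =
  B_mx alpha G *m x - (1 - alpha) *: x.
Proof.
move=> x_sum xv0 x_supp; apply/matrixP => i j; rewrite ord1 {j}.
rewrite [RHS]mxE [in X in _ + X]mxE [in X in _ - X]mxE !B_mxE.
under eq_bigr do rewrite adj_del_edges_at.
have [-> | ivN] := eqVneq i v.
  (* After the deletion [v] is isolated, so its row on the left vanishes. *)
  rewrite big1 => [|j _]; last by rewrite andbF mul0r.
  (* Zero is written as a multiple of the full sum of [x] to compare termwise: where [x j 0] is
     nonzero, [j] is a neighbour of [v]. *)
  rewrite xv0 mulr0 subr0; transitivity ((2 * alpha - 1) * \sum_j x j 0).
    by rewrite x_sum mulr0.
  rewrite mulr_sumr; apply: eq_bigr => j _; rewrite addr0.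
  have [->|/x_supp ->] := eqVneq (x j 0) 0; first by rewrite !mulr0.
  by rewrite mul1r.
(* For [i != v] the two sums differ only in the term [j = v]. *)
rewrite (bigD1 v) //= [in RHS](bigD1 v) //= eqxx andbF mul0r add0r xv0.
rewrite mulr0 add0r.
under eq_bigr => j jv do rewrite jv andbT.
suff -> : (adj G i v)%:R * ((1 - alpha) * x i 0) = (1 - alpha) * x i 0.
  by rewrite addrAC subrr add0r.
have [->|/x_supp] := eqVneq (x i 0) 0; first by rewrite !mulr0.
by rewrite adj_sym => ->; rewrite mul1r.
Qed.

Theorem theorem3p7 (R : realType) (alpha : R) (halpha : 0 <= alpha <= 1)
    (n : nat) (G : sgraph n) (lambda : R) (x : 'cV[R]_n)
    (hsum : \sum_i x i 0 = 0) (v : 'I_n) (hv : x v 0 = 0)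
    (hadj : forall u : 'I_n, x u 0 != 0 -> adj G v u) :
  B_mx alpha G *m x = lambda *: x <->
  B_mx alpha (del_edges G (edges_at G v)) *m x = (lambda - 1 + alpha) *: x.
Proof.
rewrite B_mx_del_edges_at //.
have -> : lambda - 1 + alpha = lambda - (1 - alpha) by ring.
(* Both sides are now shifted by the same vector [(1 - alpha) *: x], which cancels. *)
by rewrite (scalerBl lambda); split=> [->|/addIr].
Qed.
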